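(* Let $(X,d,\mu)$ be a metric measure space such that $(X,d)$ is bounded and $0<\mu(X)<\infty$, and assume that for some $s>0$ and $b>0$, \[ \mu(B(x,r))\ge b r^s \qquad \text{for all } x\in X,\ 0<r\le \operatorname{diam} X . \] Let $0<p<\infty$, let $u\in M^{1,p}(X)$ and let $g\in D(u)\cap L^p(X)$. Below, $C_{s,p}$ denotes a positive constant depending only on $s$ and $p$, and $c_s,C_s$ denote positive constants depending only on $s$ (possibly different at each occurrence). (1) If $0<p<s$ and $p^*=\frac{sp}{s-p}$, then \[ \inf_{\gamma\in\mathbb R}\Vert u-\gamma\Vert_{p^*}\le C_{s,p}\, b^{-1/s}\Vert g\Vert_p . \] If $p^*\ge 1$, then $u_X$ is defined and one may take $\gamma=u_X$ after changing the constant to $2C_{s,p}$, i.e. $\Vert u-u_X\Vert_{p^*}\le 2C_{s,p}b^{-1/s}\Vert g\Vert_p$. If $1\le p<s$, one can take in the displayed inequality \[ C_{s,p}=64\cdot 2^s\left(\frac{s-1}{s-p}\right)^{1/s'},\qquad s'=\frac{s}{s-1}. \] (2) If $p=s>1$ and $\Vert g\Vert_s>0$, then \[ \frac{1}{\mu(X)}\int_X \exp\!\left[c_s\left(\frac{b^{1/s}|u-u_X|}{\Vert g\Vert_s}\right)^{\frac{s}{s-1}}\right]d\mu\le C_s . \] If $p=s$ and $0<s\le 1$, then \[ \Vert u-u_X\Vert_\infty\le C_s b^{-1/s}\Vert g\Vert_s . \] (3) If $s<p<\infty$, then \[ \Vert u-u_X\Vert_\infty\le C_{s,p}\, b^{-1/s}\mu(X)^{1/s-1/p}\Vert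 g\Vert_p . \]
   Context: A metric measure space $(X,d,\mu)$ is a metric space $(X,d)$ with at least two points, equipped with a Borel measure $\mu$ such that $0<\mu(B(x,r))<\infty$ for all $x\in X$, $r\in(0,\infty)$; $B(x,r)$ is the open ball. For a measurable function $u$ on $X$, $D(u)$ is the class of measurable functions $g\ge 0$ on $X$ for which there is a set $N$ with $\mu(N)=0$ such that $|u(x)-u(y)|\le d(x,y)(g(x)+g(y))$ for all $x,y\in X\setminus N$. For $0<p\le\infty$, $M^{1,p}(X)$ is the set of all $u\in L^p(X)$ such that $D(u)\cap L^p(X)\ne\varnothing$. $\Vert f\Vert_p=(\int_X|f|^p\,d\mu)^{1/p}$ for $0<p<\infty$ (a quasinorm when $p<1$), and $\Vert f\Vert_\infty$ is the essential supremum. $u_X=\mu(X)^{-1}\int_X u\,d\mu$. *)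

(* Defs.v *)
From HB Require Import structures.
From mathcomp Require Import all_boot all_order all_algebra.
From mathcomp Require Import all_classical all_reals all_analysis.

Set Implicit Arguments.
Unset Strict Implicit.
Unset Printing Implicit Defensive.

Import Order.TTheory GRing.Theory Num.Theory.
Import numFieldNormedType.Exports.

Local Open Scope classical_set_scope.
Local Open Scope ring_scope.

(* [measurableType] is built on [pointedType], so the carrier comes with a
   distinguished point; the spaces considered below are non-empty anyway. *)
HB.mixin Record Measurable_isBorel (R : realType) (d : measure_display) T
    & Metric R T & Measurable d T := {
  measurable_borelE : (measurable : set (set T)) = <<s @open T >>
}.

#[short(type="borelMetricType")]
HB.structure Definition BorelMetric (R : realType) (d : measure_display) :=
  { T of Metric R T & Measurable d T & Measurable_isBorel R d T }.

Section MetricMeasure.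
Context (R : realType) (d : measure_display) (X : borelMetricType R d).
Implicit Types (mu : {measure set X -> \bar R}) (u g : X -> R) (p : \bar R).

(* In a [metricType], [ball x r] is the open ball [set y | mdist x y < r]. *)
Definition metric_measure_space mu : Prop :=
  (exists x y : X, x != y) /\
  (forall (x : X) (r : R), 0 < r -> (0 < mu (ball x r) < +oo)%E).

Definition metric_bounded : Prop :=
  exists M : R, forall x y : X, mdist x y <= M.

(* Meaningful only when [metric_bounded] holds: [sup] of an unbounded set is 0. *)
Definition diam : R := sup [set mdist z.1 z.2 | z in [set: X * X]].

Definition ball_lower_bound mu (s b : R) : Prop :=
  forall (x : X) (r : R), 0 < r <= diam -> ((b * r `^ s)%:E <= mu (ball x r))%E.

Definition Lp mu p : set (X -> R) :=
  [set f : X -> R | measurable_fun [set: X] f /\ finite_norm mu p f].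

Definition hajlasz_gradients mu u : set (X -> R) :=
  [set g : X -> R | [/\ measurable_fun [set: X] g,
      (forall x, 0 <= g x) &
      exists N : set X, [/\ measurable N, mu N = 0%E &
        forall x y : X, ~ N x -> ~ N y ->
          `|u x - u y| <= mdist x y * (g x + g y)]]].

Definition hajlasz_sobolev mu p : set (X -> R) :=
  [set u : X -> R | Lp mu p u /\ (hajlasz_gradients mu u `&` Lp mu p) !=set0].

Definition average mu u : R :=
  (fine (mu [set: X]))^-1 * \int[mu]_x u x.

Definition standing_hypotheses mu (s b p : R) u g : Prop :=
  [/\ metric_measure_space mu,
      metric_bounded,
      (0 < mu [set: X] < +oo)%E,
      0 < b & ball_lower_bound mu s b] /\
  hajlasz_sobolev mu p%:E u /\ (hajlasz_gradients mu u `&` Lp mu p%:E) g.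

End MetricMeasure.

Arguments diam {R d} X.
Arguments metric_bounded {R d} X.

(* Main.v *)
(** Chaining over dyadic sublevel sets of [g].  Put [t_i = 2^i l], where
    [l^p mu(X) = 2 \int g^p], so that [{g <= l}] has positive measure by
    Chebyshev's inequality.  If [b r^s > mu {g > t_i}], a ball of radius [r]
    cannot be contained in [{g > t_i}], hence a point with [g <= 2 t_i] lies
    within [r] of a point with [g <= t_i].  Descending through the levels gives,
    for almost every [x] with [g x <= t_n] and a fixed constant [gamma],
    [|u x - gamma| <= b^(-1/s) (2 l mu(X)^(1/s) + 3 \sum_(i<n) t_i mu{g > t_i}^(1/s))].
    Since [\sum_i t_i^p mu{g > t_i}] is at most a multiple of [\int g^p],
    Hoelder's inequality bounds the last sum by a multiple of
    [t_n^(1 - p/s) (\int g^p)^(1/s)] if [p < s], of [n^(1 - 1/s) |g|_s] if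
    [p = s > 1], and uniformly in [n] in the other cases.  As [t_n] is comparable
    to [max (l, g x)], each of these is a pointwise bound of [u - gamma] in terms
    of [g], which is then integrated. *)
Require Import Defs.
From HB Require Import structures.
From mathcomp Require Import all_boot all_order all_algebra.
From mathcomp Require Import all_classical all_reals all_analysis.
From mathcomp Require Import measurable_realfun ess_sup_inf ring lra.

Set Implicit Arguments.
Unset Strict Implicit.
Unset Printing Implicit Defensive.

Import Order.TTheory GRing.Theory Num.Theory.
Import numFieldNormedType.Exports.

Local Open Scope classical_set_scope.
Local Open Scope ring_scope.

(** * Dyadic sums *)

Section dyadic_sums.
Context {R : realType}.
Implicit Types (a p s x y t z : R) (n : nat).

Lemma young_powR a b x y : 0 <= a -> 0 <= b -> 0 < x -> 0 < y -> x + y = 1 ->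
  a `^ x * b `^ y <= x * a + y * b.
Proof.
move=> a0 b0 x0 y0 xy.
have := @conjugate_powR _ (a `^ x) (b `^ y) x^-1 y^-1 (powR_ge0 _ _) (powR_ge0 _ _).
rewrite !invr_gt0 !invrK => /(_ x0 y0 xy).
by rewrite -!powRrM !divff ?gt_eqF// !powRr1// [a * x]mulrC [b * y]mulrC.
Qed.

(** After dividing [a] by [A] and [b] by [B], Young's inequality holds term by term and the
    right-hand sides add up to at most [x + y = 1]. *)
Lemma discrete_hoelder n (a b : nat -> R) A B x y :
  (forall i, 0 <= a i) -> (forall i, 0 <= b i) -> 0 < A -> 0 < B ->
  0 < x -> 0 < y -> x + y = 1 ->
  \sum_(i < n) a i <= A -> \sum_(i < n) b i <= B ->
  \sum_(i < n) a i `^ x * b i `^ y <= A `^ x * B `^ y.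
Proof.
move=> a0 b0 A0 B0 x0 y0 xy sA sB.
have AB0 : 0 < A `^ x * B `^ y by rewrite mulr_gt0// powR_gt0.
have -> : \sum_(i < n) a i `^ x * b i `^ y =
    A `^ x * B `^ y * \sum_(i < n) (a i / A) `^ x * (b i / B) `^ y.
  rewrite mulr_sumr; apply: eq_bigr => i _.
  rewrite mulrACA -!powRM ?divr_ge0 ?(ltW A0) ?(ltW B0)//.
  by rewrite ![_ * (_ / _)]mulrC !divfK ?gt_eqF.
rewrite ger_pMr//.
apply: (@le_trans _ _ (\sum_(i < n) (x * (a i / A) + y * (b i / B)))).
  by apply: ler_sum => i _; apply: young_powR; rewrite ?divr_ge0 ?(ltW A0) ?(ltW B0).
rewrite big_split/= -!mulr_sumr -!mulr_suml -xy lerD//.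
  by rewrite ger_pMr// ler_pdivrMr// mul1r.
by rewrite ger_pMr// ler_pdivrMr// mul1r.
Qed.

Definition dyadic t (i : nat) : R := 2 ^+ i * t.

Lemma dyadic0 t : dyadic t 0 = t. Proof. by rewrite /dyadic mul1r. Qed.

Lemma dyadicS t i : dyadic t i.+1 = 2 * dyadic t i.
Proof. by rewrite /dyadic exprS mulrA. Qed.

Lemma dyadic_gt0 t i : 0 < t -> 0 < dyadic t i.
Proof. by move=> t0; rewrite mulr_gt0// exprn_gt0. Qed.

Lemma sum_dyadic_powR t a n : 0 < t -> 2 `^ a != 1 ->
  \sum_(i < n) dyadic t i `^ a = (dyadic t n `^ a - t `^ a) / (2 `^ a - 1).
Proof.
move=> t0 q1; elim: n => [|n IH]; first by rewrite big_ord0 dyadic0 subrr mul0r.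
rewrite big_ord_recr/= IH dyadicS powRM ?(ltW (dyadic_gt0 _ _))//.
by field; rewrite subr_eq0.
Qed.

Lemma powR2_gt1 a : 0 < a -> 1 < 2 `^ a.
Proof.
by move=> a0; rewrite -[ltLHS](powRr0 2) /powR pnatr_eq0/= ltr_expR mul0r mulr_gt0// ln_gt0// ltr1n.
Qed.

Lemma powR2_lt1 a : a < 0 -> 2 `^ a < 1.
Proof.
by move=> a0; rewrite -[a]opprK powRN invf_lt1 ?powR_gt0// powR2_gt1// oppr_gt0.
Qed.

Lemma sum_dyadic_le t a n : 0 < t -> 0 < a ->
  \sum_(i < n) dyadic t i `^ a <= dyadic t n `^ a / (2 `^ a - 1).
Proof.
move=> t0 a0; have q1 := powR2_gt1 a0.
rewrite sum_dyadic_powR ?gt_eqF// ler_pM2r ?invr_gt0 ?subr_gt0//.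
by rewrite gerBl powR_ge0.
Qed.

Lemma sum_dyadic_le_neg t a n : 0 < t -> a < 0 ->
  \sum_(i < n) dyadic t i `^ a <= t `^ a / (1 - 2 `^ a).
Proof.
move=> t0 a0; have q1 := powR2_lt1 a0.
rewrite sum_dyadic_powR ?lt_eqF// -mulrNN -invrN !opprB.
by rewrite ler_pM2r ?invr_gt0 ?subr_gt0// gerBl powR_ge0.
Qed.

Lemma half_le_ln2 : 2^-1 <= ln 2 :> R.
Proof.
have : ln (1 + - 2^-1) <= - 2^-1 :> R by apply: le_ln1Dx; lra.
have -> : 1 + - 2^-1 = 2^-1 :> R by lra.
by rewrite lnV ?posrE// lerN2.
Qed.

(** Follows from [1 + t <= exp t] at [t = a ln 2] and [ln 2 >= 1/2]. It replaces the denominator of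
    a geometric sum by one linear in [a], as the explicit constant requires. *)
Lemma powR2_sub1_ge a : 0 <= a -> a / 2 <= 2 `^ a - 1.
Proof.
move=> a0; rewrite /powR pnatr_eq0/= lerBrDl.
by rewrite (le_trans _ (expR_ge1Dx _))// lerD2l ler_wpM2l// half_le_ln2.
Qed.

(** The bound does not depend on [n]. Taken at [z = g x] and integrated, it controls the sum of
    [t_i^p mu{g > t_i}] by the integral of [g^p]. *)
Lemma sum_dyadic_lt z t p n : 0 < t -> 0 < p -> 0 <= z ->
  \sum_(i < n) (if dyadic t i < z then dyadic t i `^ p else 0) <=
  z `^ p / (1 - 2 `^ (- p)).
Proof.
move=> t0 p0 z0; have q1 := powR2_gt1 p0; have q0 := lt_trans ltr01 q1.
have c0 : 0 < 1 - 2 `^ (- p) by rewrite subr_gt0 powR2_lt1// oppr_lt0.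
elim: n => [|n IH].
  by rewrite big_ord0 divr_ge0 ?powR_ge0// ltW.
rewrite big_ord_recr/=; case: ifPn => [tz|_]; last by rewrite addr0.
(* If even the last level lies below [z], all the conditions may be dropped: the full geometric sum
   is at most a constant times its last term, which is at most [z^p]. *)
apply: (@le_trans _ _ (\sum_(i < n.+1) dyadic t i `^ p)).
  rewrite big_ord_recr/= lerD2r; apply: ler_sum => i _.
  by case: ifPn => //; rewrite powR_ge0.
rewrite (le_trans (sum_dyadic_le _ t0 p0))// dyadicS powRM ?(ltW (dyadic_gt0 _ _))//.
have -> : (1 - 2 `^ (- p)) = (2 `^ p - 1) / 2 `^ p.
  by rewrite powRN; field; rewrite gt_eqF.
rewrite invf_div mulrA [2 `^ p * _]mulrC ler_pM2r ?invr_gt0 ?subr_gt0//.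
rewrite ler_pM2r// ge0_ler_powR ?nnegrE ?(ltW p0) ?(ltW tz)//.
exact/ltW/dyadic_gt0.
Qed.

(** * Dyadic sums weighted by level measures, general exponents *)

Section weighted.
Variables (s p t H : R) (m : nat -> R).
Hypotheses (s0 : 0 < s) (t0 : 0 < t) (H0 : 0 < H).
Hypotheses (m0 : forall i, 0 <= m i)
  (mH : forall n, \sum_(i < n) dyadic t i `^ p * m i <= H).

Let term_ge0 i : 0 <= dyadic t i `^ p * m i.
Proof. by rewrite mulr_ge0// powR_ge0. Qed.

Lemma weighted_term i : dyadic t i `^ p * m i <= H.
Proof.
apply: le_trans (mH i.+1); rewrite big_ord_recr/= lerDr.
by apply: sumr_ge0.
Qed.

(** Separates a purely geometric factor from the quantity [t_i^p m_i], whose partial sums are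
    bounded by [H]. *)
Lemma weighted_termE i : dyadic t i * m i `^ (1 / s) =
  dyadic t i `^ (1 - p / s) * (dyadic t i `^ p * m i) `^ (1 / s).
Proof.
have d0 := dyadic_gt0 i t0.
rewrite powRM ?powR_ge0// -powRrM mulrA -powRD ?(gt_eqF d0) ?implybT//.
by rewrite mulrA mulr1 subrK powRr1 ?(ltW d0).
Qed.

(** Each [t_i^p m_i] is at most [H]; what remains is a geometric sum, dominated by its last term if
    [p < s] and by its first if [p > s]. *)
Lemma weighted_sum_le n : \sum_(i < n) dyadic t i * m i `^ (1 / s) <=
  H `^ (1 / s) * \sum_(i < n) dyadic t i `^ (1 - p / s).
Proof.
rewrite mulr_sumr; apply: ler_sum => i _; rewrite weighted_termE mulrC.
rewrite ler_wpM2r ?powR_ge0// ge0_ler_powR ?nnegrE ?divr_ge0 ?(ltW s0) ?(ltW H0)//.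
exact: weighted_term.
Qed.

Lemma weighted_sum_subcritical n : p < s ->
  \sum_(i < n) dyadic t i * m i `^ (1 / s) <=
  (2 `^ (1 - p / s) - 1)^-1 * (H `^ (1 / s) * dyadic t n `^ (1 - p / s)).
Proof.
move=> ps; rewrite (le_trans (weighted_sum_le n))// mulrCA ler_wpM2l ?powR_ge0//.
by rewrite [leRHS]mulrC sum_dyadic_le// subr_gt0 ltr_pdivrMr// mul1r.
Qed.

(** Hoelder's inequality with exponents [1 - 1/s] and [1/s] uses the whole sum bound [H] rather than
    a bound on each term. This puts the power [1 - 1/s] on the factor [(s - 1) / (s - p)], which
    blows up as [p] tends to [s]. *)
Lemma weighted_sum_subcritical_hoelder n : 1 < s -> p < s ->
  \sum_(i < n) dyadic t i * m i `^ (1 / s) <=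
  (2 * ((s - 1) / (s - p))) `^ (1 - 1 / s) *
    (H `^ (1 / s) * dyadic t n `^ (1 - p / s)).
Proof.
(* [a] is chosen so that [a (1 - 1/s) = 1 - p/s]: the geometric factor is then the power [1 - 1/s]
   of [t_i^a]. *)
move=> s1 ps; pose a := (s - p) / (s - 1).
have a0 : 0 < a by rewrite divr_gt0 ?subr_gt0.
have x0 : 0 < 1 - 1 / s by rewrite subr_gt0 ltr_pdivrMr// mul1r.
have y0 : 0 < 1 / s by rewrite divr_gt0.
have aE : a * (1 - 1 / s) = 1 - p / s.
  by rewrite /a; field; rewrite (gt_eqF s0) subr_eq0 (gt_eqF s1).
have d0 i := dyadic_gt0 i t0.
have A0 : 0 < 2 * ((s - 1) / (s - p)) * dyadic t n `^ a.
  by rewrite !mulr_gt0 ?powR_gt0 ?invr_gt0 ?subr_gt0.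
have := @discrete_hoelder n (fun i => dyadic t i `^ a)
  (fun i => dyadic t i `^ p * m i) (2 * ((s - 1) / (s - p)) * dyadic t n `^ a) H
  (1 - 1 / s) (1 / s) (fun i => powR_ge0 _ _) term_ge0 A0 H0 x0 y0 (subrK _ _).
rewrite powRM ?powR_ge0//; last first.
  by rewrite mulr_ge0// divr_ge0// subr_ge0 ltW.
rewrite -powRrM aE => /(_ _ (mH n)) HH.
under eq_bigr do rewrite weighted_termE -aE powRrM.
rewrite [X in _ <= _ * X]mulrC [leRHS]mulrA; apply: HH; rewrite (le_trans (sum_dyadic_le _ t0 a0))// mulrC ler_wpM2r ?powR_ge0//.
rewrite (_ : 2 * ((s - 1) / (s - p)) = (a / 2)^-1); last first.
  rewrite /a; field; rewrite !subr_eq0 (gt_eqF s1) (gt_eqF ps)//.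
by rewrite lef_pV2 ?posrE ?divr_gt0 ?subr_gt0 ?powR2_gt1// powR2_sub1_ge// ltW.
Qed.

Lemma weighted_sum_supercritical n : s < p ->
  \sum_(i < n) dyadic t i * m i `^ (1 / s) <=
  (1 - 2 `^ (1 - p / s))^-1 * (H `^ (1 / s) * t `^ (1 - p / s)).
Proof.
move=> sp; rewrite (le_trans (weighted_sum_le n))// mulrCA ler_wpM2l ?powR_ge0//.
by rewrite [leRHS]mulrC sum_dyadic_le_neg// subr_lt0 ltr_pdivlMr// mul1r.
Qed.
End weighted.

(** * Weighted dyadic sums at the critical exponent *)

Section critical.
Variables (s t H : R) (m : nat -> R).
Hypotheses (s0 : 0 < s) (t0 : 0 < t) (H0 : 0 < H).
Hypotheses (m0 : forall i, 0 <= m i)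
  (mH : forall n, \sum_(i < n) dyadic t i `^ s * m i <= H).

Lemma weighted_sum_critical n : 1 < s ->
  \sum_(i < n) dyadic t i * m i `^ (1 / s) <=
  (n%:R + 1) `^ (1 - 1 / s) * H `^ (1 / s).
Proof.
move=> s1.
have x0 : 0 < 1 - 1 / s by rewrite subr_gt0 ltr_pdivrMr// mul1r.
have y0 : 0 < 1 / s by rewrite divr_gt0.
(* At [p = s] the geometric factor is constantly [1]. Its sum [n] is replaced by [n + 1] because a
   positive bound is required also for [n = 0]. *)
have := @discrete_hoelder n (fun i => 1)
  (fun i => dyadic t i `^ s * m i) (n%:R + 1) H
  (1 - 1 / s) (1 / s) _ _ _ H0 x0 y0 (subrK _ _).
have -> : \sum_(i < n) 1 `^ (1 - 1 / s) * (dyadic t i `^ s * m i) `^ (1 / s) =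
    \sum_(i < n) dyadic t i * m i `^ (1 / s).
  apply: eq_bigr => i _; have d0 := dyadic_gt0 i t0.
  rewrite powR1 mul1r powRM ?powR_ge0// -powRrM mulrA mulr1 divff ?gt_eqF//.
  by rewrite powRr1 ?ltW.
apply => //.
- by move=> i; rewrite mulr_ge0 ?powR_ge0.
- by rewrite sumr_const card_ord lerDl.
Qed.

(** Write [c^r = c * c^(r - 1)] for [c = a] and [c = b], and bound the second factor by
    [(a + b)^(r - 1)]. *)
Lemma powR_superadditive a b r : 0 <= a -> 0 <= b -> 1 <= r ->
  a `^ r + b `^ r <= (a + b) `^ r.
Proof.
move=> a0 b0 r1; have r0 : 0 < r by rewrite (lt_le_trans ltr01).
have key c : 0 <= c -> c <= a + b -> c `^ r <= c * (a + b) `^ (r - 1).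
  move=> c0 cab; rewrite -(mulr_powRB1 c0 r0) ler_wpM2l//.
  by rewrite ge0_ler_powR ?nnegrE ?subr_ge0// addr_ge0.
rewrite -(mulr_powRB1 (addr_ge0 a0 b0) r0) mulrDl.
by rewrite lerD// key// ?lerDl ?lerDr.
Qed.

(** As [1/s >= 1], superadditivity moves the power outside the sum, so no factor growing with [n]
    appears. *)
Lemma weighted_sum_critical_le1 n : s <= 1 ->
  \sum_(i < n) dyadic t i * m i `^ (1 / s) <= H `^ (1 / s).
Proof.
move=> s1; have r1 : 1 <= 1 / s by rewrite ler_pdivlMr// mul1r.
have tm0 i : 0 <= dyadic t i `^ s * m i by rewrite mulr_ge0 ?powR_ge0.
apply: (@le_trans _ _ ((\sum_(i < n) dyadic t i `^ s * m i) `^ (1 / s))).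
  elim: n => [|n IH]; first by rewrite !big_ord0 powR_ge0.
  rewrite !big_ord_recr/=.
  apply: le_trans (powR_superadditive _ _ r1) => //; last exact: sumr_ge0.
  apply: lerD => //; have d0 := dyadic_gt0 n t0.
  rewrite powRM ?powR_ge0// -powRrM mulrA mulr1 divff ?gt_eqF//.
  by rewrite powRr1 ?(ltW d0).
rewrite ge0_ler_powR ?nnegrE ?divr_ge0 ?(ltW s0) ?(ltW H0)//.
exact: sumr_ge0.
Qed.
End critical.

End dyadic_sums.

(** * Dyadic sum bounds in terms of the energy *)

Section dyadic_sum_bounds.
Context {R : realType}.
Implicit Types (s p k : R) (E : R -> nat -> R).

(* [E l n] is the dependence on the level: a power of [dyadic l n], of [l], or
   of [n + 1], according to the sign of [s - p]. *)
Definition dyadic_sum_bound s p k E := forall (l G : R) (m : nat -> R) n,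
  0 < l -> 0 < G -> (forall i, 0 <= m i) ->
  (forall n, \sum_(i < n) dyadic l i `^ p * m i <= G / (1 - 2 `^ (- p))) ->
  \sum_(i < n) dyadic l i * m i `^ (1 / s) <= k * (G `^ (1 / s) * E l n).

Lemma one_sub_powR2_gt0 p : 0 < p -> 0 < 1 - 2 `^ (- p) :> R.
Proof. by move=> p0; rewrite subr_gt0 powR2_lt1// oppr_lt0. Qed.

Lemma dyadic_sum_bound_subcritical s p : 0 < p -> p < s ->
  dyadic_sum_bound s p
    ((2 `^ (1 - p / s) - 1)^-1 * (1 - 2 `^ (- p))^-1 `^ (1 / s))
    (fun l n => dyadic l n `^ (1 - p / s)).
Proof.
move=> p0 ps l G m n l0 G0 m0 mG.
have c0 := one_sub_powR2_gt0 p0.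
have s0 : 0 < s := lt_trans p0 ps.
rewrite (le_trans (weighted_sum_subcritical s0 l0 _ m0 mG _ ps)) ?divr_gt0//.
rewrite -[leRHS]mulrA powRM ?invr_ge0 ?(ltW G0) ?(ltW c0)//.
by rewrite [G `^ _ * _]mulrC -!mulrA.
Qed.

Lemma dyadic_sum_bound_supercritical s p : 0 < s -> s < p ->
  dyadic_sum_bound s p
    ((1 - 2 `^ (1 - p / s))^-1 * (1 - 2 `^ (- p))^-1 `^ (1 / s))
    (fun l n => l `^ (1 - p / s)).
Proof.
move=> s0 sp l G m n l0 G0 m0 mG.
have p0 : 0 < p := lt_trans s0 sp.
have c0 := one_sub_powR2_gt0 p0.
rewrite (le_trans (weighted_sum_supercritical s0 l0 _ m0 mG _ sp)) ?divr_gt0//.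
rewrite -[leRHS]mulrA powRM ?invr_ge0 ?(ltW G0) ?(ltW c0)//.
by rewrite [G `^ _ * _]mulrC -!mulrA.
Qed.

(** The level factor [l^(1 - s/s)] equals [1]; it is kept in this form so that [p = s <= 1] can be
    treated together with [p > s]. *)
Lemma dyadic_sum_bound_critical_le1 s : 0 < s -> s <= 1 ->
  dyadic_sum_bound s s ((1 - 2 `^ (- s))^-1 `^ (1 / s))
    (fun l n => l `^ (1 - s / s)).
Proof.
move=> s0 s1 l G m n l0 G0 m0 mG; have c0 := one_sub_powR2_gt0 s0.
rewrite (le_trans (weighted_sum_critical_le1 s0 l0 _ m0 mG _ s1)) ?divr_gt0//.
rewrite divff ?gt_eqF// subrr powRr0 mulr1 mulrC.
by rewrite powRM ?invr_ge0 ?(ltW G0) ?(ltW c0).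
Qed.

(** For [p >= 1] one has [2^(-p) <= 1/2], so the factor depending on [p] becomes a numeral, as
    needed for explicit constants. *)
Lemma div_one_sub_powR2_le p G : 1 <= p -> 0 <= G -> G / (1 - 2 `^ (- p)) <= 2 * G.
Proof.
move=> p1 G0; rewrite mulrC ler_wpM2r//.
rewrite -[leRHS]invrK lef_pV2 ?posrE ?invr_gt0//; last first.
  by rewrite one_sub_powR2_gt0// (lt_le_trans ltr01).
have : 2 `^ (- p) <= 2 `^ (- 1) :> R by rewrite ler_powR ?ler1n// lerN2.
by rewrite powR_inv1//; lra.
Qed.

Lemma dyadic_sum_bound_hoelder s p : 1 <= p -> p < s ->
  dyadic_sum_bound s p (2 * ((s - 1) / (s - p)) `^ (1 - 1 / s))
    (fun l n => dyadic l n `^ (1 - p / s)).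
Proof.
move=> p1 ps l G m n l0 G0 m0 mG.
have p0 : 0 < p := lt_le_trans ltr01 p1.
have s0 : 0 < s := lt_trans p0 ps.
have s1 : 1 < s := le_lt_trans p1 ps.
have mG2 n' : \sum_(i < n') dyadic l i `^ p * m i <= 2 * G.
  by rewrite (le_trans (mG n'))// div_one_sub_powR2_le// ltW.
rewrite (le_trans (weighted_sum_subcritical_hoelder s0 l0 _ m0 mG2 _ s1 ps)) ?mulr_gt0//.
have A0 : 0 <= (s - 1) / (s - p) by rewrite divr_ge0 ?subr_ge0 ?(ltW s1) ?(ltW ps).
rewrite !(@powRM _ 2) ?(ltW G0)//.
(* One power of [2] comes from the geometric sum, the other from the energy bound [2 * G]; they
   multiply to exactly [2]. *)
rewrite [leLHS](_ : _ = (2 `^ (1 - 1 / s) * 2 `^ (1 / s)) * ((s - 1) / (s - p)) `^ (1 - 1 / s) * (G `^ (1 / s) * dyadic l n `^ (1 - p / s))).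
  by rewrite -powRD ?pnatr_eq0 ?implybT// subrK powRr1.
by ring.
Qed.

Lemma dyadic_sum_bound_critical s : 1 < s ->
  dyadic_sum_bound s s 2 (fun l n => (n%:R + 1) `^ (1 - 1 / s)).
Proof.
move=> s1 l G m n l0 G0 m0 mG.
have s0 : 0 < s := lt_trans ltr01 s1.
have mG2 n' : \sum_(i < n') dyadic l i `^ s * m i <= 2 * G.
  by rewrite (le_trans (mG n'))// div_one_sub_powR2_le// ltW.
rewrite (le_trans (weighted_sum_critical s0 l0 _ m0 mG2 _ s1)) ?mulr_gt0//.
rewrite mulrC mulrA ler_wpM2r ?powR_ge0// powRM ?(ltW G0)// ler_wpM2r ?powR_ge0//.
by rewrite ler1_powR ?ler1n// ler_pdivrMr// mul1r ltW.
Qed.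

(** Taking the least level above [z] makes [dyadic l n] comparable to the maximum of [l] and [z],
    which turns bounds in [n] into bounds in [g x]. *)
Lemma exists_dyadic_level (l z : R) : 0 < l ->
  exists n, z <= dyadic l n /\ (n = 0%N \/ dyadic l n < 2 * z).
Proof.
move=> l0; have ex : exists n, z <= dyadic l n.
  have [n zn] : exists n : nat, z / l <= n%:R.
    exists (Num.truncn `|z / l|).+1.
    by rewrite (le_trans (ler_norm _))// ltW// truncnS_gt.
  exists n; rewrite /dyadic -ler_pdivrMr// (le_trans zn)// -natrX ler_nat.
  exact/ltnW/ltn_expl.
have := ex_minnP ex; case=> -[|n] zn nmin; first by exists 0%N; split; [|left].
exists n.+1; split => //; right; rewrite dyadicS ltr_pM2l// ltNge.
by apply/negP => /nmin; rewrite ltnn.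
Qed.
End dyadic_sum_bounds.

(** * Chaining through the sublevel sets of the gradient *)

Section chaining.
Context {R : realType} {d : measure_display} (X : borelMetricType R d).
Variable mu : {measure set X -> \bar R}.

Lemma measurable_ball (x : X) (r : R) : measurable (ball x r).
Proof.
rewrite measurable_borelE; apply: sub_sigma_algebra.
rewrite /= openE => y; rewrite ballEmdist/= => xy.
apply/nbhs_ballP; exists (r - mdist x y) => /=; first by rewrite subr_gt0.
move=> z; rewrite !ballEmdist/= ltrBrDl; exact/le_lt_trans/metric_triangle.
Qed.

Lemma mdist_le_diam (x y : X) : metric_bounded X -> mdist x y <= diam X.
Proof.
move=> [D HD]; apply: ub_le_sup; last by exists (x, y).
by exists D => _ [[v w] _ <-]; exact: HD.
Qed.

Lemma diam_gt0 : metric_bounded X -> (exists x y : X, x != y) -> 0 < diam X.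
Proof.
by move=> bX [x [y xy]]; apply: lt_le_trans (mdist_le_diam x y bX); rewrite mdist_gt0.
Qed.

Variables (s b : R) (u g : X -> R) (N : set X).
Hypotheses (s0 : 0 < s) (b0 : 0 < b) (bX : metric_bounded X)
  (ntX : exists x y : X, x != y) (muX : (mu [set: X] < +oo)%E)
  (lbX : ball_lower_bound mu s b).
Hypotheses (mg : measurable_fun [set: X] g) (mN : measurable N) (N0 : mu N = 0%E)
  (gN : forall x y : X, ~ N x -> ~ N y ->
    `|u x - u y| <= mdist x y * (g x + g y)).

Definition level (t : R) : R := fine (mu [set x | t < g x]).

Let M := fine (mu [set: X]).

Lemma measurable_superlevel t : measurable [set x | t < g x].
Proof.
rewrite [X in measurable X](_ : _ = setT `&` g @^-1` `]t, +oo[).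
  exact: mg.
by rewrite setTI; apply/seteqP; split => x/=; rewrite in_itv/= andbT.
Qed.

Lemma fin_num_mu (A : set X) : measurable A -> mu A \is a fin_num.
Proof.
move=> mA; rewrite ge0_fin_numE ?measure_ge0//.
by apply: le_lt_trans muX; apply: le_measure; rewrite ?inE.
Qed.

Lemma level_ge0 t : 0 <= level t. Proof. exact/fine_ge0/measure_ge0. Qed.

Lemma levelE t : mu [set x | t < g x] = (level t)%:E.
Proof. by rewrite fineK// fin_num_mu//; exact: measurable_superlevel. Qed.

(** Otherwise [A] would lie in the union of [N] and [{g > t}], whose measure is at most
    [level t]. *)
Lemma exists_sublevel (A : set X) (t : R) : measurable A ->
  ((level t)%:E < mu A)%E -> exists y, [/\ A y, ~ N y & g y <= t].
Proof.
move=> mA; apply: contraPP => /forallNP noy; apply/negP; rewrite -leNgt.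
have mS := measurable_superlevel t.
apply: (@le_trans _ _ (mu (N `|` [set x | t < g x]))).
  apply: le_measure; rewrite ?inE//; first exact: measurableU.
  move=> y Ay; have [Ny|Ny] := pselect (N y); first by left.
  by right => /=; rewrite ltNge; apply/negP => gy; apply: (noy y).
have NS : (mu (N `|` [set x | (t < g x)%R]) <= mu N + mu [set x | (t < g x)%R])%E.
  exact: measureU2.
by rewrite (le_trans NS)// N0 add0e levelE.
Qed.

Lemma near_sublevel (t r : R) (x : X) : 0 < r -> level t < M ->
  level t < b * r `^ s -> exists y, [/\ ~ N y, g y <= t & mdist x y < r].
Proof.
move=> r0 tM tr; have [rD|Dr] := leP r (diam X).
  have [||y [+ Ny gy]] := @exists_sublevel (ball x r) t.
  - exact: measurable_ball.
  - by apply: (lt_le_trans _ (lbX _ _)); rewrite ?lte_fin// r0.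
  by rewrite ballEmdist => xy; exists y.
have [//||y [_ Ny gy]] := @exists_sublevel [set: X] t.
  by rewrite -[mu _]fineK ?lte_fin// fin_num_mu.
by exists y; split => //; exact: le_lt_trans (mdist_le_diam _ _ bX) Dr.
Qed.

(** The lower bound at radius [diam X] gives [b (diam X)^s <= M]. It bounds the length of the last
    step of the chain. *)
Lemma diam_le : diam X <= b `^ (- (1 / s)) * M `^ (1 / s).
Proof.
have D0 := diam_gt0 bX ntX; have [x _] := ntX.
have bD : b * diam X `^ s <= M.
  rewrite -lee_fin fineK ?fin_num_mu// (le_trans (lbX x _)) ?D0 ?lexx//.
  by apply: le_measure; rewrite ?inE//; exact: measurable_ball.
rewrite powRN -ler_pdivrMl ?invr_gt0 ?powR_gt0// invrK.
have -> : diam X = (diam X `^ s) `^ (1 / s).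
  by rewrite -powRrM mulrA mulr1 divff ?gt_eqF// powRr1// ltW.
rewrite -powRM ?powR_ge0 ?(ltW b0)//.
rewrite ge0_ler_powR ?nnegrE ?divr_ge0 ?mulr_ge0 ?powR_ge0 ?(ltW b0) ?(ltW s0)//.
exact/fine_ge0/measure_ge0.
Qed.

Lemma hajlasz_chain (l : R) : 0 < l -> level l < M -> exists gamma : R,
  forall n x, ~ N x -> g x <= dyadic l n -> `|u x - gamma| <= b `^ (- (1 / s)) *
    (2 * l * M `^ (1 / s) +
     3 * \sum_(i < n) dyadic l i * level (dyadic l i) `^ (1 / s)).
Proof.
move=> l0 lM; have D0 := diam_gt0 bX ntX.
have [//||y [_ Ny gy]] := @exists_sublevel [set: X] l.
  by rewrite -[mu _]fineK ?lte_fin// fin_num_mu.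
(* The value of [u] at one point of the lowest sublevel set serves for every [n]; for [n = 0] a
   single step of length at most [diam X] reaches that point. *)
exists (u y); elim=> [|n IH] x Nx gx.
  rewrite big_ord0 mulr0 addr0 (le_trans (gN Nx Ny))//.
  rewrite dyadic0 in gx; rewrite mulrCA.
  apply: (@le_trans _ _ (diam X * (2 * l))); last first.
    by rewrite mulrC ler_wpM2l ?diam_le// mulr_ge0// ltW.
  apply: (@le_trans _ _ (mdist x y * (2 * l))).
    by rewrite ler_wpM2l ?mdist_ge0// mulrDl !mul1r lerD.
  by rewrite ler_wpM2r ?mulr_ge0 ?(ltW l0)// mdist_le_diam.
set t := dyadic l n; have t0 : 0 < t by exact: dyadic_gt0.
have tM : level t < M.
  apply: le_lt_trans lM; rewrite -lee_fin -!levelE.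
  apply: le_measure; rewrite ?inE; try exact: measurable_superlevel.
  move=> z /=; apply: le_lt_trans; rewrite /t /dyadic ler_peMl ?(ltW l0)//.
  by rewrite exprn_ege1 ?ler1n.
set r0 := b `^ (- (1 / s)) * level t `^ (1 / s).
have r00 : 0 <= r0 by rewrite mulr_ge0 ?powR_ge0.
rewrite big_ord_recr/= -/t.
set S := \sum_(i < n) _ in IH *.
have -> : b `^ (- (1 / s)) *
    (2 * l * M `^ (1 / s) + 3 * (S + t * level t `^ (1 / s))) =
  b `^ (- (1 / s)) * (2 * l * M `^ (1 / s) + 3 * S) + 3 * t * r0.
  by rewrite /r0; ring.
(* The radius [r0] solves [b r0^s = level t], while [near_sublevel] needs a strict inequality and a
   positive radius. The enlargement costs exactly [e], since [g x + g z <= 2 t + t]. *)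
apply/ler_addgt0Pr => e e0; pose r := r0 + e / (3 * t).
have rr0 : r0 < r by rewrite ltrDl divr_gt0// mulr_gt0.
have tr : level t < b * r `^ s.
  have -> : level t = b * r0 `^ s.
    rewrite /r0 powRM ?powR_ge0// -!powRrM mulNr div1r mulVf ?gt_eqF//.
    by rewrite powR_inv1 ?(ltW b0)// mulVKf ?gt_eqF// powRr1 ?level_ge0.
  by rewrite ltr_pM2l// gt0_ltr_powR ?nnegrE// (le_trans r00)// ltW.
have [|z [Nz gz xz]] := near_sublevel x _ tM tr; first exact: le_lt_trans rr0.
rewrite -(subrKA (u z)) (le_trans (ler_normD _ _))// addrC -addrA lerD//.
  exact: IH.
have -> : 3 * t * r0 + e = r * (3 * t).
  by rewrite /r; field; rewrite gt_eqF.
rewrite (le_trans (gN Nx Nz))//.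
rewrite dyadicS -/t in gx.
apply: (@le_trans _ _ (mdist x z * (3 * t))).
  rewrite ler_wpM2l ?mdist_ge0// (_ : 3 * t = 2 * t + t); last by ring.
  exact: lerD.
by rewrite ler_wpM2r ?(ltW xz)// mulr_ge0// ltW.
Qed.

(** Exchanging sum and integral reduces the claim to the pointwise hypothesis at [z = g x]. A single
    term gives Chebyshev's inequality, dyadic weights give the summed version. *)
Lemma sum_level_le (p K : R) n (c t : nat -> R) : 0 <= K -> (forall i, 0 <= c i) ->
  (forall x, 0 <= g x) ->
  (\int[mu]_x (g x `^ p)%:E < +oo)%E ->
  (forall z, 0 <= z -> \sum_(i < n) (if t i < z then c i else 0) <= K * z `^ p) ->
  \sum_(i < n) c i * level (t i) <= K * fine (\int[mu]_x (g x `^ p)%:E).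
Proof.
move=> K0 c0 g0 gp ctz.
have mgp : measurable_fun [set: X] (fun x => (g x `^ p)%:E : \bar R).
  apply/measurable_EFinP; apply: (measurableT_comp (measurable_powR p)) => //.
have gp0 : (0 <= \int[mu]_x (g x `^ p)%:E)%E.
  by apply: integral_ge0 => x _; rewrite lee_fin powR_ge0.
rewrite -lee_fin EFinM fineK ?ge0_fin_numE//.
rewrite -ge0_integralZl_EFin//; last by move=> x _; rewrite lee_fin powR_ge0.
rewrite -sumEFin.
have -> : (\sum_(i < n) (c i * level (t i))%:E =
  \int[mu]_x \sum_(i < n) (c i * \1_[set x | (t i < g x)%R] x)%:E)%E.
  rewrite ge0_integral_sum//; last 2 first.
  - move=> i; apply/measurable_EFinP; apply: measurable_funM => //.
    exact/measurable_indic/measurable_superlevel.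
  - by move=> i x _; rewrite lee_fin mulr_ge0.
  apply: eq_bigr => i _.
  under eq_integral do rewrite EFinM.
  rewrite ge0_integralZl_EFin//; last first.
    by apply/measurable_EFinP; exact/measurable_indic/measurable_superlevel.
  rewrite integral_indic//; last exact: measurable_superlevel.
  by rewrite setIT levelE.
apply: ge0_le_integral => //.
- by move=> x _; apply: sume_ge0 => i _; rewrite lee_fin mulr_ge0.
- apply: emeasurable_sum => i; apply/measurable_EFinP; apply: measurable_funM => //.
  exact/measurable_indic/measurable_superlevel.
- exact: measurable_funeM.
move=> x _; rewrite sumEFin -EFinM lee_fin (le_trans _ (ctz _ (g0 x)))//.
apply: ler_sum => i _; rewrite indicE.
case: ifPn => h; first by rewrite mem_set// mulr1.
by rewrite memNset ?mulr0//; exact/negP.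
Qed.

End chaining.

(** * Averages *)

Section averages.
Context {R : realType} {d : measure_display} (X : borelMetricType R d).
Variable mu : {measure set X -> \bar R}.
Hypotheses (mu0 : (0 < mu [set: X])%E) (muy : (mu [set: X] < +oo)%E).

Let M := fine (mu [set: X]).

Lemma mu_setTE : mu [set: X] = M%:E.
Proof. by rewrite fineK// ge0_fin_numE. Qed.

Lemma mu_setT_gt0 : 0 < M. Proof. by rewrite fine_gt0// mu0. Qed.

Lemma integrable_cstr (c : R) : mu.-integrable [set: X] (EFin \o cst c).
Proof.
apply/integrableP; split; first exact/measurable_EFinP/measurable_cst.
by under eq_integral do rewrite /=; rewrite integral_cst// mu_setTE ltry.
Qed.

(** The difference [average mu u - gamma] is the mean of [u - gamma]; finiteness of the total mass
    makes constants integrable. *)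
Lemma dist_average_le (u : X -> R) (gamma B : R) : measurable_fun [set: X] u ->
  (\int[mu]_x `|u x - gamma|%:E <= (B * M)%:E)%E ->
  mu.-integrable [set: X] (EFin \o u) /\ `|average mu u - gamma| <= B.
Proof.
move=> mfu uB; pose v := fun x => u x - gamma.
have mv : measurable_fun [set: X] v by exact: measurable_funB.
have iv : mu.-integrable [set: X] (EFin \o v).
  apply/integrableP; split; first exact/measurable_EFinP.
  by rewrite (le_lt_trans uB)// ltry.
have iu : mu.-integrable [set: X] (EFin \o u).
  rewrite (_ : EFin \o u = (EFin \o v) \+ (EFin \o cst gamma))%E.
    by apply: integrableD => //; exact: integrable_cstr.
  by apply/funext => x /=; rewrite -EFinD subrK.
split => //; have M0 := mu_setT_gt0.
have -> : average mu u - gamma = M^-1 * \int[mu]_x v x.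
  rewrite RintegralB//; last exact: integrable_cstr.
  by rewrite Rintegral_cst// /average -/M mulrBr mulrCA mulVf ?gt_eqF// mulr1.
rewrite normrM ger0_norm ?invr_ge0 ?(ltW M0)// ler_pdivrMl// mulrC.
rewrite (le_trans (le_normr_Rintegral _ _))//.
rewrite -lee_fin fineK//.
by apply: integrable_fin_num => //; exact: integrable_norm.
Qed.

Lemma LnormE (q : R) (f : X -> R) : ('N[mu]_(q%:E)[(fun x => (f x)%:E)] =
  (\int[mu]_x (`|f x| `^ q)%:E) `^ (1 / q))%E.
Proof. by rewrite unlock div1r. Qed.

(** Hoelder's inequality against the constant [1] bounds the mean deviation by [B M^(-1/q)], so the
    constant function [gamma - average mu u] has norm at most [B], and Minkowski's inequality yields
    [2 * B]. *)
Lemma Lnorm_sub_average (q B : R) (u : X -> R) (gamma : R) : 1 <= q ->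
  measurable_fun [set: X] u ->
  ('N[mu]_(q%:E)[(fun x => (u x - gamma)%:E)] <= B%:E)%E ->
  mu.-integrable [set: X] (EFin \o u) /\
  ('N[mu]_(q%:E)[(fun x => (u x - average mu u)%:E)] <= (2 * B)%:E)%E.
Proof.
move=> q1 mfu uB; pose v := fun x => u x - gamma.
have mv : measurable_fun [set: X] v by exact: measurable_funB.
have M0 := mu_setT_gt0; have q0 : 0 < q by rewrite (lt_le_trans ltr01).
have B0 : 0 <= B by rewrite -lee_fin (le_trans (Lnorm_ge0 _ _ _) uB).
have [|iu av] := @dist_average_le u gamma (B * M `^ (- (1 / q))) mfu.
  have -> : B * M `^ (- (1 / q)) * M = B * M `^ (1 - 1 / q).
    rewrite -mulrA; congr (_ * _); rewrite powRB ?(gt_eqF M0) ?implybT//.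
    by rewrite powRr1 ?(ltW M0)// powRN mulrC.
  (* The conjugate exponent is infinite at [q = 1], where the hypothesis already is the integral
     bound. *)
  move: q1; rewrite le_eqVlt => /predU1P[q1|q1].
    move: uB; rewrite -q1 divr1 subrr powRr0 mulr1; apply: le_trans.
    by rewrite Lnorm1.
  have x0 : 0 < 1 - 1 / q by rewrite subr_gt0 ltr_pdivrMr// mul1r.
  have := @hoelder _ _ _ mu v (cst 1) q (1 - 1 / q)^-1 mv (measurable_cst _) q0.
  rewrite invr_gt0 invrK => /(_ x0); rewrite div1r subrKC => /(_ erefl).
  rewrite Lnorm1 Lnorm_cst1 invrK mu_setTE.
  have -> : (\int[mu]_x `|(EFin \o (v \* cst 1)%R) x| = \int[mu]_x `|u x - gamma|%:E)%E.
    by apply: eq_integral => x _ /=; rewrite mulr1.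
  move/le_trans; apply; rewrite EFinM.
  by rewrite poweR_EFin lee_wpmul2r ?lee_fin ?powR_ge0.
split => //.
have -> : (fun x => (u x - average mu u)%:E) =
    (EFin \o (v \+ cst (gamma - average mu u))%R).
  by apply/funext => x /=; rewrite addrA subrK.
apply: (le_trans (minkowski_EFin _ _ _ q1)) => //.
rewrite mulrDl mul1r EFinD; apply: leeD => //.
rewrite LnormE /= integral_cst// mu_setTE -EFinM poweR_EFin lee_fin.
rewrite powRM ?powR_ge0 ?(ltW M0)// -powRrM mulrA mulr1 divff ?gt_eqF// powRr1//.
by rewrite distrC -ler_pdivlMr ?powR_gt0// -powRN.
Qed.

Lemma ae_bounded_average (B : R) (u : X -> R) (gamma : R) :
  measurable_fun [set: X] u -> {ae mu, forall x, `|u x - gamma| <= B} ->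
  mu.-integrable [set: X] (EFin \o u) /\
  ('N[mu]_(+oo)[(fun x => (u x - average mu u)%:E)] <= (2 * B)%:E)%E.
Proof.
move=> mfu uB.
have [|iu av] := @dist_average_le u gamma B mfu.
  rewrite EFinM -mu_setTE -integral_cst//.
  have [B0|B0] := leP 0 B.
    apply: ae_ge0_le_integral => //.
    - by apply/measurable_EFinP/measurableT_comp => //; exact: measurable_funB.
    - by apply: filterS uB => x uB _; rewrite lee_fin.
  (* A negative [B] would make the almost everywhere bound fail at every point. *)
  suff: mu [set: X] = 0%E by move=> h; move: mu0; rewrite h ltxx.
  apply/negligibleP => //.
  by apply: negligibleS uB => x _ /=; apply/negP; rewrite -ltNge (lt_le_trans B0).
split => //; rewrite unlock mu0; apply/ess_supP.
apply: filterS uB => x uB /=; rewrite lee_fin.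
by rewrite -(subrKA gamma) (le_trans (ler_normD _ _))// mulrDl mul1r lerD// distrC.
Qed.

End averages.

(** * Estimates *)

Section pointwise.
Context {R : realType} {d : measure_display} (X : borelMetricType R d).
Variables (mu : {measure set X -> \bar R}) (s b p : R) (u g : X -> R).
Hypotheses (s0 : 0 < s) (p0 : 0 < p) (hyp : standing_hypotheses mu s b p u g).

Definition mass : R := fine (mu [set: X]).
Definition energy : R := fine (\int[mu]_x (g x `^ p)%:E).
(* Chebyshev's inequality: at most half of the mass lies above this level. *)
Definition base_level : R := (2 * energy / mass) `^ (1 / p).

Let M := mass.
Let G := energy.
Let l := base_level.

Lemma g_ge0 x : 0 <= g x. Proof. by have [_ [_ [[_ ? _] _]]] := hyp. Qed.

Lemma measurable_g : measurable_fun [set: X] g.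
Proof. by have [_ [_ [[? _ _] _]]] := hyp. Qed.

Lemma measurable_u : measurable_fun [set: X] u.
Proof. by have [_ [[[? _] _] _]] := hyp. Qed.

Lemma b_gt0 : 0 < b. Proof. by have [[]] := hyp. Qed.

Lemma mu_gt0 : (0 < mu [set: X])%E.
Proof. by have [[_ _ /andP[]]] := hyp. Qed.

Lemma mu_lty : (mu [set: X] < +oo)%E.
Proof. by have [[_ _ /andP[]]] := hyp. Qed.

Lemma mass_gt0 : 0 < M. Proof. exact: mu_setT_gt0 mu_gt0 mu_lty. Qed.

Lemma measurable_gp : measurable_fun [set: X] (fun x => (g x `^ p)%:E : \bar R).
Proof.
by apply/measurable_EFinP/(measurableT_comp (measurable_powR p)); exact: measurable_g.
Qed.

Lemma energyE : (\int[mu]_x (g x `^ p)%:E = G%:E)%E.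
Proof.
rewrite fineK// ge0_fin_numE; last first.
  by apply: integral_ge0 => x _; rewrite lee_fin powR_ge0.
have [_ [_ [_ [_]]]] := hyp; rewrite /finite_norm LnormE => /lty_poweRy.
rewrite gt_eqF ?divr_gt0// => /(_ isT).
by under eq_integral do rewrite ger0_norm ?g_ge0//.
Qed.

Lemma Lnorm_gE : ('N[mu]_(p%:E)[EFin \o g] = (G `^ (1 / p))%:E)%E.
Proof.
rewrite LnormE -poweR_EFin -energyE; congr poweR.
by apply: eq_integral => x _; rewrite ger0_norm ?g_ge0.
Qed.

Lemma energy_ge0 : 0 <= G.
Proof. by apply: fine_ge0; apply: integral_ge0 => x _; rewrite lee_fin powR_ge0. Qed.

Lemma base_level_powR : l `^ p * M = 2 * G.
Proof.
have M0 := mass_gt0; rewrite /l /base_level -powRrM mul1r mulVf ?gt_eqF//.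
rewrite powRr1 ?divfK ?gt_eqF// divr_ge0 ?mulr_ge0 ?(ltW M0)//.
exact: energy_ge0.
Qed.

(** Eliminating the mass through [l^p M = 2 G] gives the first term of the chaining bound the same
    shape as the dyadic sum. *)
Lemma base_levelM : 0 < G ->
  l * M `^ (1 / s) = 2 `^ (1 / s) * (G `^ (1 / s) * l `^ (1 - p / s)).
Proof.
move=> G0; have M0 := mass_gt0.
have l0 : 0 < l by rewrite powR_gt0// divr_gt0// mulr_gt0.
rewrite mulrA -powRM ?(ltW G0)// -base_level_powR powRM ?powR_ge0 ?(ltW M0)//.
rewrite -powRrM mulrAC -powRD ?(gt_eqF l0) ?implybT//.
by rewrite mulrA mulr1 addrC subrK powRr1 ?(ltW l0).
Qed.

(** Here the base level is [0] and there are no dyadic levels to chain through; but [g] vanishes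
    almost everywhere, so the gradient inequality itself makes [u] constant. *)
Lemma constant_off_null : G = 0 -> exists gamma : R, {ae mu, forall x, u x = gamma}.
Proof.
move=> G00; have [_ [_ [[mg _ [N [mN N0 gN]]] _]]] := hyp.
have ae0 : {ae mu, forall x, g x = 0}.
  have : (\int[mu]_x `|(g x `^ p)%:E| = 0)%E.
    under eq_integral do rewrite gee0_abs ?lee_fin ?powR_ge0//.
    by rewrite energyE G00.
  move=> /(ae_eq_integral_abs mu measurableT measurable_gp); apply: filterS => x /(_ I) [].
  by move=> /powR_eq0_eq0.
have aeN : {ae mu, forall x, ~ N x}.
  by exists N; split => // x /= /contrapT.
have aeB : {ae mu, forall x, ~ N x /\ g x = 0} by apply: filterS2 aeN ae0.
have [y [Ny gy]] : exists y, ~ N y /\ g y = 0.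
  apply: contrapT => /forallNP no.
  have : mu [set: X] = 0%E.
    by apply/negligibleP => //; apply: negligibleS aeB => x _ /=; exact: no.
  by move=> h; have := mu_gt0; rewrite h ltxx.
exists (u y); apply: filterS aeB => x [Nx gx].
apply/eqP; rewrite -subr_eq0 -normr_le0 (le_trans (gN _ _ Nx Ny))//.
by rewrite gx gy addr0 mulr0.
Qed.

Lemma pointwise_dyadic k E : 0 < G -> dyadic_sum_bound s p k E ->
  exists gamma : R, {ae mu, forall x, forall n, g x <= dyadic l n ->
    `|u x - gamma| <= b `^ (- (1 / s)) * G `^ (1 / s) *
      (2 * 2 `^ (1 / s) * l `^ (1 - p / s) + 3 * k * E l n)}.
Proof.
move=> G0 kE; have M0 := mass_gt0.
have l0 : 0 < l by rewrite powR_gt0// divr_gt0// mulr_gt0.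
have [[[ntX _] bX _ b0 lbX] [_ [[mg g0 [N [mN N0 gN]]] _]]] := hyp.
have muX := mu_lty.
have gy : (\int[mu]_x (g x `^ p)%:E < +oo)%E by rewrite energyE ltry.
have lM : level mu g l < M.
  (* Chebyshev's inequality: [l^p level l <= G < 2 G = l^p M]. *)
  have := @sum_level_le _ _ _ mu g muX mg p 1 1 (fun=> l `^ p) (fun=> l)
    ler01 (fun=> powR_ge0 _ _) g0 gy.
  rewrite big_ord_recr big_ord0/= add0r mul1r -/energy -/G => h.
  rewrite -(@ltr_pM2l _ (l `^ p)); last exact: powR_gt0.
  rewrite base_level_powR (le_lt_trans (h _))//; last by rewrite ltr_pMl ?ltr1n.
  move=> z z0; rewrite big_ord_recr big_ord0/= add0r mul1r.
  case: ifPn => lz; last by rewrite powR_ge0.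
  by rewrite ge0_ler_powR ?nnegrE ?(ltW p0) ?(ltW l0) ?(ltW lz).
have [gamma hg] := hajlasz_chain s0 b0 bX ntX muX lbX mg mN N0 gN l0 lM.
exists gamma.
have aeN : {ae mu, forall x, ~ N x}.
  by exists N; split => // x /= /contrapT.
apply: filterS aeN => x Nx n gx; rewrite (le_trans (hg n x Nx gx))//.
rewrite -[leRHS]mulrA ler_wpM2l ?powR_ge0// -!mulrA base_levelM//.
rewrite [leRHS](_ : _ = 2 * (2 `^ (1 / s) * (G `^ (1 / s) * l `^ (1 - p / s))) +
   3 * (k * (G `^ (1 / s) * E l n))); last by ring.
rewrite lerD2l ler_pM2l//; apply: (kE l G (fun i => level mu g (dyadic l i))) => //.
  by move=> i; exact: level_ge0.
move=> n'; rewrite mulrC.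
apply: (@sum_level_le _ _ _ mu g muX mg p _ n' (fun i => dyadic l i `^ p) (dyadic l)) => //.
- by rewrite invr_ge0 ltW// one_sub_powR2_gt0.
- by move=> i; exact: powR_ge0.
- by move=> z z0; rewrite mulrC; exact: sum_dyadic_lt.
Qed.

End pointwise.

(** * Sobolev and sup-norm estimates *)

Section estimates.
Context {R : realType} {d : measure_display} (X : borelMetricType R d).
Variables (mu : {measure set X -> \bar R}) (s b p : R) (u g : X -> R).
Hypotheses (s0 : 0 < s) (p0 : 0 < p) (hyp : standing_hypotheses mu s b p u g).

Let M := mass mu.
Let G := energy mu p g.
Let l := base_level mu p g.

Let M0 : 0 < M := mass_gt0 hyp.
Let G0 : 0 <= G := energy_ge0 mu p g.

Lemma pointwise_subcritical k : p < s -> 0 <= k ->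
  dyadic_sum_bound s p k (fun l n => dyadic l n `^ (1 - p / s)) ->
  exists gamma : R, {ae mu, forall x, `|u x - gamma| <=
    (2 * 2 `^ (1 / s) + 6 * k) * b `^ (- (1 / s)) * G `^ (1 / s) *
    (l `^ (1 - p / s) + g x `^ (1 - p / s))}.
Proof.
move=> ps k0 kE; have K0 : 0 <= 2 * 2 `^ (1 / s) + 6 * k.
  by rewrite addr_ge0 ?mulr_ge0 ?powR_ge0.
have [G00|Gn0] := eqVneq G 0.
  have [gamma uE] := constant_off_null p0 hyp G00.
  exists gamma; apply: filterS uE => x ->; rewrite subrr normr0.
  by rewrite !mulr_ge0 ?K0 ?addr_ge0 ?powR_ge0.
have Gp : 0 < G by rewrite lt_neqAle eq_sym Gn0.
have l0 : 0 < l by rewrite powR_gt0// divr_gt0// mulr_gt0.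
have [gamma hg] := pointwise_dyadic s0 p0 hyp Gp kE.
exists gamma; apply: filterS hg => x hx.
have [n [gn ln]] := exists_dyadic_level (g x) l0.
rewrite (le_trans (hx n gn))//.
rewrite [leRHS](_ : _ = b `^ (- (1 / s)) * G `^ (1 / s) *
  ((2 * 2 `^ (1 / s) + 6 * k) * (l `^ (1 - p / s) + g x `^ (1 - p / s)))); last by ring.
rewrite ler_wpM2l ?mulr_ge0 ?powR_ge0//.
set t := 1 - p / s; have t0 : 0 < t by rewrite subr_gt0 ltr_pdivrMr// mul1r.
have t1 : t <= 1 by rewrite lerBlDr lerDl divr_ge0 ?ltW.
(* For [n > 0] the level is below [2 g x], and [2^t <= 2] because [t <= 1]; this doubles [3 * k]
   into [6 * k]. *)
have dn : dyadic l n `^ t <= l `^ t + 2 * g x `^ t.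
  case: ln => [->|ln]; first by rewrite dyadic0 lerDl mulr_ge0 ?powR_ge0.
  apply: (@le_trans _ _ ((2 * g x) `^ t)).
    have d0 := ltW (dyadic_gt0 n l0); have g0 := g_ge0 hyp x.
    by rewrite ge0_ler_powR ?nnegrE ?(ltW t0) ?(ltW ln) ?d0 ?mulr_ge0 ?g0.
  rewrite powRM ?(g_ge0 hyp)//.
  apply: (@le_trans _ _ (2 * g x `^ t)).
    by rewrite ler_wpM2r ?powR_ge0// ler1_powR ?ler1n.
  by rewrite lerDr powR_ge0.
have A0 : 0 <= 2 `^ (1 / s) :> R by exact: powR_ge0.
have B0 : 0 <= l `^ t by exact: powR_ge0.
have C0 : 0 <= g x `^ t by exact: powR_ge0.
apply: (@le_trans _ _ (2 * 2 `^ (1 / s) * l `^ t + 3 * k * (l `^ t + 2 * g x `^ t))).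
  by rewrite lerD2l ler_wpM2l// mulr_ge0.
rewrite -subr_ge0 [X in 0 <= X](_ : _ = 2 * (2 `^ (1 / s) * g x `^ t) + 3 * (k * l `^ t)).
  by rewrite addr_ge0// !mulr_ge0.
by ring.
Qed.

Lemma sobolev_subcritical k (q := s * p / (s - p)) : p < s -> 0 <= k ->
  dyadic_sum_bound s p k (fun l n => dyadic l n `^ (1 - p / s)) ->
  exists gamma : R, ('N[mu]_(q%:E)[(fun x => (u x - gamma)%:E)] <=
    (2 * 3 `^ (1 / q) * (2 * 2 `^ (1 / s) + 6 * k) * b `^ (- (1 / s)))%:E
      * 'N[mu]_(p%:E)[EFin \o g])%E.
Proof.
move=> ps k0 kE; have [gamma hg] := pointwise_subcritical ps k0 kE.
exists gamma; rewrite (Lnorm_gE p0 hyp) -/G LnormE -EFinM.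
set K := 2 * _ + 6 * k in hg *.
set A := K * _ * _ in hg.
have A0 : 0 <= A by rewrite !mulr_ge0 ?addr_ge0 ?mulr_ge0 ?powR_ge0.
have sp0 : 0 < s - p by rewrite subr_gt0.
have q0 : 0 < q by rewrite divr_gt0 ?mulr_gt0.
(* Because of this relation the [q]-th power of the pointwise bound is a multiple of [l^p + g^p];
   the next one splits [G^(1/p)] into [G^(1/s) G^(1/q)]. *)
have tq : (1 - p / s) * q = p.
  by rewrite /q; field; rewrite (gt_eqF s0) (gt_eqF sp0).
have pE : 1 / p = 1 / s + 1 / q.
  by rewrite /q; field; rewrite (gt_eqF s0) (gt_eqF sp0) (gt_eqF p0).
have -> : 2 * 3 `^ (1 / q) * K * b `^ (- (1 / s)) * G `^ (1 / p) =
    ((2 * A) `^ q * (3 * G)) `^ (1 / q).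
  have -> : ((2 * A) `^ q * (3 * G)) `^ (1 / q) = 2 * A * (3 * G) `^ (1 / q).
    rewrite powRM ?powR_ge0 ?(mulr_ge0 _ G0)// -powRrM div1r divff ?(gt_eqF q0)//.
    by rewrite powRr1 // (mulr_ge0 _ A0).
  rewrite powRM// pE powRD; last first.
    by rewrite -pE gt_eqF// divr_gt0.
  by rewrite /A; ring.
rewrite -poweR_EFin; apply: gt0_ler_poweR.
- by rewrite divr_ge0 ?(ltW q0).
- by rewrite in_itv/= leey integral_ge0// => x _; rewrite lee_fin powR_ge0.
- by rewrite in_itv/= leey lee_fin !mulr_ge0 ?powR_ge0.
have mu_ := measurable_u hyp; have mg := measurable_g hyp.
(* Since [l^p M = 2 G], the function [l^p + g^p] integrates to [3 G], whence the factor
   [3^(1/q)]. *)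
have -> : ((2 * A) `^ q * (3 * G))%:E =
    (\int[mu]_x ((2 * A) `^ q * (l `^ p + g x `^ p))%:E)%E.
  under eq_integral do rewrite EFinM.
  rewrite ge0_integralZl_EFin ?powR_ge0//; last 2 first.
  - by move=> x _; rewrite lee_fin addr_ge0 ?powR_ge0.
  - apply/measurable_EFinP/measurable_funD => //.
    exact: (measurableT_comp (measurable_powR p)).
  under eq_integral do rewrite EFinD.
  rewrite ge0_integralD//; last 3 first.
  - by move=> x _; rewrite lee_fin powR_ge0.
  - by move=> x _; rewrite lee_fin powR_ge0.
  - exact: (measurable_gp hyp).
  rewrite integral_cst// (mu_setTE (mu_lty hyp)) (energyE p0 hyp)  -[((l `^ p)%:E * _)%E]EFinM -EFinD -EFinM.
  by rewrite (base_level_powR p0 hyp) -/G; congr (_ * _)%:E; ring.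
apply: ae_ge0_le_integral => //.
- apply/measurable_EFinP/(measurableT_comp (measurable_powR q))/measurableT_comp => //.
  exact: measurable_funB.
- by move=> x _; rewrite lee_fin mulr_ge0 ?addr_ge0 ?powR_ge0.
- apply/measurable_EFinP/measurable_funM/measurable_funD => //.
  exact: (measurableT_comp (measurable_powR p)).
apply: filterS hg => x hx _; rewrite lee_fin.
apply: (@le_trans _ _ ((A * (l `^ (1 - p / s) + g x `^ (1 - p / s))) `^ q)).
  by rewrite ge0_ler_powR ?nnegrE ?(ltW q0)// mulr_ge0 ?addr_ge0 ?powR_ge0.
rewrite [(2 * A)]mulrC (powRM _ A0) ?addr_ge0 ?powR_ge0//.
rewrite (powRM _ A0)// -mulrA ler_wpM2l ?powR_ge0//.
have -> : l `^ p = (l `^ (1 - p / s)) `^ q by rewrite -powRrM tq.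
have -> : g x `^ p = (g x `^ (1 - p / s)) `^ q by rewrite -powRrM tq.
have y0 := powR_ge0 l (1 - p / s); have z0 := powR_ge0 (g x) (1 - p / s).
move: (l `^ _) (g x `^ _) y0 z0 => y z y0 z0.
(* Comparison with the larger summand works for all [q > 0], whereas convexity would need
   [q >= 1]. *)
have max2 c e : 0 <= c -> c <= e -> (c + e) `^ q <= 2 `^ q * e `^ q.
  move=> c0 ce; have e0 := le_trans c0 ce; rewrite -powRM//.
  by rewrite ge0_ler_powR ?nnegrE ?(ltW q0) ?addr_ge0 ?mulr_ge0// mulrDl mul1r lerD2r.
have [yz|zy] := leP y z.
  by rewrite (le_trans (max2 _ _ y0 yz))// ler_wpM2l ?powR_ge0// lerDr powR_ge0.
rewrite addrC (le_trans (max2 _ _ z0 (ltW zy)))// ler_wpM2l ?powR_ge0// lerDl.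
exact: powR_ge0.
Qed.

Lemma pointwise_supercritical k : s <= p -> 0 <= k ->
  dyadic_sum_bound s p k (fun l n => l `^ (1 - p / s)) ->
  exists gamma : R, {ae mu, forall x, `|u x - gamma| <=
    (2 * 2 `^ (1 / s) + 3 * k) * b `^ (- (1 / s)) * M `^ (1 / s - 1 / p) *
    G `^ (1 / p)}.
Proof.
move=> sp k0 kE; have K0 : 0 <= 2 * 2 `^ (1 / s) + 3 * k.
  by rewrite addr_ge0 ?mulr_ge0 ?powR_ge0.
have [G00|Gn0] := eqVneq G 0.
  have [gamma uE] := constant_off_null p0 hyp G00.
  exists gamma; apply: filterS uE => x ->; rewrite subrr normr0.
  by rewrite !mulr_ge0 ?powR_ge0.
have Gp : 0 < G by rewrite lt_neqAle eq_sym Gn0.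
have l0 : 0 < l by rewrite powR_gt0// divr_gt0// mulr_gt0.
have [gamma hg] := pointwise_dyadic s0 p0 hyp Gp kE.
exists gamma; apply: filterS hg => x hx.
have [n [gn _]] := exists_dyadic_level (g x) l0.
rewrite (le_trans (hx n gn))//.
rewrite -mulrDl [leLHS](_ : _ = (2 * 2 `^ (1 / s) + 3 * k) * b `^ (- (1 / s)) *
  (G `^ (1 / s) * l `^ (1 - p / s))); last by ring.
rewrite -[leRHS]mulrA ler_wpM2l ?mulr_ge0 ?powR_ge0//.
have -> : l `^ (1 - p / s) = 2 `^ (1 / p - 1 / s) * G `^ (1 / p - 1 / s) * M `^ (1 / s - 1 / p).
  rewrite /l /base_level -powRrM [1 / p * _](_ : _ = 1 / p - 1 / s); last first.
    by field; rewrite (gt_eqF s0) (gt_eqF p0).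
  rewrite powRM ?invr_ge0 ?mulr_ge0 ?(ltW M0)// powRM//.
  rewrite -(powR_inv1 (ltW M0)) -powRrM mulN1r opprB.
  by [].
rewrite [leLHS](_ : _ = 2 `^ (1 / p - 1 / s) * M `^ (1 / s - 1 / p) *
  (G `^ (1 / s) * G `^ (1 / p - 1 / s))); last by ring.
rewrite -powRD ?(gt_eqF Gp) ?implybT// subrKC ler_wpM2r ?powR_ge0//.
(* The leftover factor [2^(1/p - 1/s)] is at most [1] since [s <= p]. *)
rewrite ler_piMl ?powR_ge0// -[leRHS](powRr0 2) ler_powR ?ler1n//.
by rewrite subr_le0 !div1r lef_pV2 ?posrE.
Qed.

Lemma sobolev_supercritical k : s <= p -> 0 <= k ->
  dyadic_sum_bound s p k (fun l n => l `^ (1 - p / s)) ->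
  mu.-integrable [set: X] (EFin \o u) /\
  ('N[mu]_(+oo)[(fun x => (u x - average mu u)%:E)] <=
    (2 * (2 * 2 `^ (1 / s) + 3 * k) * b `^ (- (1 / s)) *
      fine (mu [set: X]) `^ (1 / s - 1 / p))%:E * 'N[mu]_(p%:E)[EFin \o g])%E.
Proof.
move=> sp k0 kE; have [gamma hg] := pointwise_supercritical sp k0 kE.
have [iu uN] := ae_bounded_average (mu_gt0 hyp) (mu_lty hyp) (measurable_u hyp) hg.
by split => //; rewrite (Lnorm_gE p0 hyp) -EFinM -!mulrA; move: uN; rewrite -!mulrA.
Qed.

End estimates.

(** * Exponential integrability for [p = s > 1] *)

Section exponential.
Context {R : realType} {d : measure_display} (X : borelMetricType R d).
Variables (mu : {measure set X -> \bar R}) (s b : R) (u g : X -> R).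
Hypotheses (s1 : 1 < s) (hyp : standing_hypotheses mu s b s u g).

Let s0 : 0 < s := lt_trans ltr01 s1.
Let s' := s / (s - 1).
Let M := mass mu.
Let G := energy mu s g.
Let l := base_level mu s g.
Let M0 : 0 < M := mass_gt0 hyp.

Hypothesis G0 : 0 < G.

(* With this rate, [rescaled <= 10 (n + 1)^(1 - 1/s)] on [{g <= 2^n l}] turns
   into the bound [2^(s (n + 1))], comparable to [(g / l)^s], of the exponential. *)
Definition exp_rate (s : R) : R := s * ln 2 / 10 `^ (s / (s - 1)).

Let c0 := exp_rate s.

Let s'_gt0 : 0 < s'. Proof. by rewrite divr_gt0// subr_gt0. Qed.

Let s'_ge1 : 1 <= s'.
Proof. by rewrite ler_pdivlMr ?subr_gt0// mul1r gerBl. Qed.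

Let c0_gt0 : 0 < c0.
Proof. by rewrite divr_gt0 ?powR_gt0// mulr_gt0// ln_gt0// ltr1n. Qed.

Let l0 : 0 < l.
Proof. by rewrite powR_gt0// divr_gt0// mulr_gt0. Qed.

Let rescaled (gamma : R) x : R := b `^ (1 / s) * `|u x - gamma| / G `^ (1 / s).

Let rescaled_ge0 gamma x : 0 <= rescaled gamma x.
Proof. by rewrite divr_ge0 ?mulr_ge0 ?powR_ge0. Qed.

Lemma pointwise_exponential : exists gamma : R, {ae mu, forall x,
  expR (c0 * rescaled gamma x `^ s') <= 4 `^ s * (1 + (g x / l) `^ s)}.
Proof.
have b0 := b_gt0 hyp.
have [gamma hg] := pointwise_dyadic s0 s0 hyp G0 (dyadic_sum_bound_critical s1).
exists gamma; apply: filterS hg => x hx.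
have [n [gn ln]] := exists_dyadic_level (g x) l0.
have n1 : 1 <= (n%:R + 1) `^ (1 - 1 / s) :> R.
  rewrite -[leLHS](powRr0 (n%:R + 1)) ler_powR ?lerDr//.
  by rewrite subr_ge0 ler_pdivrMr// mul1r ltW.
(* The [10] is [4 + 6]: [2 * 2^(1/s) <= 4] from the base step, and [3 * 2] from the critical dyadic
   sum. *)
have wn : rescaled gamma x <= 10 * (n%:R + 1) `^ (1 - 1 / s).
  rewrite /rescaled ler_pdivrMr ?powR_gt0// mulrC -ler_pdivlMr ?powR_gt0//.
  rewrite (le_trans (hx n gn))// divff ?(gt_eqF s0)// subrr powRr0 mulr1.
  rewrite powRN [leRHS]mulrC -mulrA ler_wpM2l ?invr_ge0 ?powR_ge0//.
  rewrite [leRHS]mulrC ler_wpM2l ?powR_ge0//.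
  have : 2 `^ (1 / s) <= 2 :> R by rewrite ler1_powR ?ler1n// ler_pdivrMr// mul1r ltW.
  by lra.
have wsn : rescaled gamma x `^ s' <= 10 `^ s' * (n%:R + 1).
  apply: (@le_trans _ _ ((10 * (n%:R + 1) `^ (1 - 1 / s)) `^ s')).
    by rewrite ge0_ler_powR ?nnegrE ?(ltW s'_gt0) ?rescaled_ge0 ?mulr_ge0 ?powR_ge0.
  rewrite powRM ?powR_ge0// -powRrM.
  rewrite (_ : (1 - 1 / s) * s' = 1) ?powRr1 ?addr_ge0//.
  by rewrite /s'; field; rewrite subr_eq0 (gt_eqF s1) (gt_eqF s0).
apply: (@le_trans _ _ ((2 * 2 ^+ n) `^ s)).
  rewrite -exprS -powR_mulrn// -powRrM /powR pnatr_eq0/= ler_expR.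
  apply: (@le_trans _ _ (c0 * (10 `^ s' * (n%:R + 1)))).
    by rewrite ler_wpM2l// ltW.
  rewrite /c0 /exp_rate -/s' -natr1 mulrA divfK; last first.
    by rewrite gt_eqF// powR_gt0.
  by rewrite le_eqVlt; apply/orP; left; apply/eqP; ring.
have g0 : 0 <= g x / l by rewrite divr_ge0 ?(g_ge0 hyp) ?ltW.
(* At the base level [2^s <= 4^s] suffices; above it [2^n l < 2 g x] gives
   [2 * 2^n <= 4 (g x / l)]. *)
case: ln => [->|ln].
  rewrite expr0 mulr1 (@le_trans _ _ (4 `^ s))//.
    by rewrite ge0_ler_powR ?nnegrE ?(ltW s0)// ler_nat.
  by rewrite ler_peMr ?powR_ge0// lerDl powR_ge0.
apply: (@le_trans _ _ (4 `^ s * (g x / l) `^ s)).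
  rewrite -powRM//.
  rewrite ge0_ler_powR ?nnegrE ?(ltW s0) ?(mulr_ge0 _ g0) ?(mulr_ge0 _ (exprn_ge0 _ _))//.
  rewrite mulrA ler_pdivlMr// -mulrA.
  by move: ln; rewrite /dyadic; lra.
by rewrite ler_wpM2l ?powR_ge0// lerDr.
Qed.

Let Q : R := 2 * 4 `^ s.

Let measurable_rescaled gamma : measurable_fun [set: X] (rescaled gamma).
Proof.
apply: measurable_funM => //; apply: measurable_funM => //.
apply: measurableT_comp => //; apply: measurable_funB => //.
exact: measurable_u hyp.
Qed.

Let measurable_expR_rescaled c gamma :
  measurable_fun [set: X] (fun x => (expR (c * rescaled gamma x `^ s'))%:E : \bar R).
Proof.
apply/measurable_EFinP/measurableT_comp => //; apply: measurable_funM => //.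
exact: (measurableT_comp (measurable_powR s')).
Qed.

Lemma integral_exponential : exists gamma : R,
  (\int[mu]_x (expR (c0 * rescaled gamma x `^ s'))%:E <= (Q * M)%:E)%E.
Proof.
have [gamma hg] := pointwise_exponential; exists gamma.
have mg := measurable_g hyp; have g0 := g_ge0 hyp.
have mgs : measurable_fun [set: X] (fun x => (l `^ (- s) * g x `^ s)%:E : \bar R).
  apply/measurable_EFinP/measurable_funM => //.
  exact: (measurableT_comp (measurable_powR s)).
apply: (@le_trans _ _ (\int[mu]_x ((4 `^ s)%:E * (1 + (l `^ (- s) * g x `^ s)%:E)))%E).
  apply: ae_ge0_le_integral => //.
  - by move=> x _; rewrite -EFinD -EFinM lee_fin !mulr_ge0 ?addr_ge0 ?mulr_ge0 ?powR_ge0.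
  - apply: measurable_funeM; exact: emeasurable_funD.
  apply: filterS hg => x + _; rewrite -EFinD -EFinM lee_fin.
  by rewrite powRM ?invr_ge0 ?(ltW l0)// -(powR_inv1 (ltW l0)) -powRrM mulN1r [_ * g x `^ s]mulrC.
rewrite ge0_integralZl_EFin ?powR_ge0//; last 2 first.
- by move=> x _; rewrite -EFinD lee_fin addr_ge0 ?mulr_ge0 ?powR_ge0.
- exact: emeasurable_funD.
rewrite ge0_integralD//; last by move=> x _; rewrite lee_fin mulr_ge0 ?powR_ge0.
under [X in (_ + X)%E]eq_integral do rewrite EFinM.
rewrite ge0_integralZl_EFin ?powR_ge0//; last 2 first.
- by move=> x _; rewrite lee_fin powR_ge0.
- exact: (measurable_gp hyp).
rewrite integral_cst// mul1e (mu_setTE (mu_lty hyp)) (energyE s0 hyp).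
rewrite -[((l `^ _)%:E * _)%E]EFinM -EFinD -EFinM lee_fin -/(mass mu) -/M -/G.
(* Hence [1 + (g / l)^s] integrates to [3 M / 2], which is at most [2 M]; this is the [2] in [Q]. *)
have lM : l `^ (- s) * G = M / 2.
  have := base_level_powR s0 hyp; rewrite -/(mass mu) -/M -/G -/l => lM.
  have -> : G = l `^ s * M / 2 by rewrite lM; field.
  by rewrite powRN; field; rewrite gt_eqF// powR_gt0.
rewrite lM /Q mulrAC mulrC ler_wpM2r ?powR_ge0//.
by move: M0; lra.
Qed.

(** Passes from [gamma] to the average. As [w <= 1 + exp(c0 w^s') / c0], the rescaled distance
    between the two is at most [W]. The inequality [(w + W)^s' <= 2^s' (w^s' + W^s')] then costs a
    factor [2^s'] in the rate and [exp(c0 W^s')] in the bound. *)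
Lemma exponential_integrability (c := c0 / 2 `^ s')
    (W := 1 + Q / c0) : mu.-integrable [set: X] (EFin \o u) /\
  (\int[mu]_x (expR (c * rescaled (average mu u) x `^ s'))%:E <=
     (expR (c0 * W `^ s') * Q * M)%:E)%E.
Proof.
have [gamma hg] := integral_exponential.
have b0 := b_gt0 hyp.
have Q0 : 0 <= Q by rewrite mulr_ge0 ?powR_ge0.
have W0 : 0 <= W by rewrite /W addr_ge0 // mulr_ge0 // invr_ge0 (ltW c0_gt0).
pose k := b `^ (- (1 / s)) * G `^ (1 / s).
have k0 : 0 < k by rewrite mulr_gt0 ?powR_gt0.
have uk x : `|u x - gamma| = k * rescaled gamma x.
  rewrite /k /rescaled powRN; field.
  by rewrite !gt_eqF ?powR_gt0.
have wexp x : rescaled gamma x <= 1 + expR (c0 * rescaled gamma x `^ s') / c0.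
  have w0 := rescaled_ge0 gamma x; set w := rescaled _ _ in w0 *.
  have [w1|w1] := leP w 1.
    by rewrite (le_trans w1)// lerDl divr_ge0 ?expR_ge0 ?ltW.
  apply: (@le_trans _ _ (w `^ s')); first exact/le1r_powR/s'_ge1/ltW.
  apply: (@le_trans _ _ (expR (c0 * w `^ s') / c0)); last by rewrite lerDr.
  by rewrite ler_pdivlMr// mulrC (le_trans _ (expR_ge1Dx _))// lerDr.
have [|iu av] := @dist_average_le _ _ _ mu (mu_gt0 hyp) (mu_lty hyp) u gamma (k * W)
    (measurable_u hyp).
  apply: (@le_trans _ _ (\int[mu]_x (k%:E *
      (1 + (c0^-1)%:E * (expR (c0 * rescaled gamma x `^ s'))%:E)))%E).
    apply: ge0_le_integral => //.
    - apply/measurable_EFinP/measurableT_comp => //; apply: measurable_funB => //.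
      exact: measurable_u hyp.
    - apply: measurable_funeM; apply: emeasurable_funD => //.
      exact: measurable_funeM.
    move=> x _; rewrite uk.
    rewrite [leRHS](_ : _ = (k * (1 + c0^-1 * expR (c0 * rescaled gamma x `^ s')))%:E)//.
    by rewrite lee_fin ler_wpM2l ?(ltW k0)// [c0^-1 * _]mulrC wexp.
  rewrite ge0_integralZl_EFin ?(ltW k0)//; last 2 first.
  - move=> x _; rewrite -EFinM -EFinD lee_fin.
    by rewrite addr_ge0 ?mulr_ge0 ?expR_ge0 ?invr_ge0 ?(ltW c0_gt0).
  - by apply: emeasurable_funD => //; exact: measurable_funeM.
  rewrite -(mulrA k) [leRHS]EFinM lee_wpmul2l ?lee_fin ?(ltW k0)//.
  rewrite ge0_integralD//; last 2 first.
  - by move=> x _; rewrite -EFinM lee_fin mulr_ge0 ?expR_ge0 ?invr_ge0 ?(ltW c0_gt0).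
  - exact: measurable_funeM.
  rewrite ge0_integralZl_EFin ?invr_ge0 ?(ltW c0_gt0)//.
  rewrite integral_cst// mul1e (mu_setTE (mu_lty hyp)) mulrDl mul1r EFinD leeD//.
  rewrite mulrAC mulrC EFinM lee_wpmul2l ?lee_fin ?invr_ge0 ?(ltW c0_gt0)//.
split => //.
rewrite -mulrA EFinM.
apply: (@le_trans _ _ (\int[mu]_x ((expR (c0 * W `^ s'))%:E *
   (expR (c0 * rescaled gamma x `^ s'))%:E))%E); last first.
  rewrite ge0_integralZl_EFin ?expR_ge0//.
  by rewrite lee_wpmul2l ?lee_fin ?expR_ge0.
apply: ge0_le_integral => //.
- exact: measurable_funeM.
move=> x _; rewrite -EFinM lee_fin -expRD ler_expR.
have w0 := rescaled_ge0 gamma x.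
have zw : rescaled (average mu u) x <= rescaled gamma x + W.
  rewrite -(@ler_pM2l _ k)// mulrDr -uk.
  have -> : k * rescaled (average mu u) x = `|u x - average mu u|.
    rewrite /k /rescaled powRN; field.
    by rewrite !gt_eqF ?powR_gt0.
  by rewrite -(subrKA gamma) (le_trans (ler_normD _ _))// lerD2l distrC.
rewrite -mulrDr /c mulrAC -mulrA ler_wpM2l ?(ltW c0_gt0)//.
rewrite ler_pdivrMr ?powR_gt0//.
apply: (@le_trans _ _ ((rescaled gamma x + W) `^ s')).
  by rewrite ge0_ler_powR ?nnegrE ?(ltW s'_gt0) ?rescaled_ge0 ?(addr_ge0 w0 W0).
move: (rescaled gamma x) w0 => w w0.
have max2 y z : 0 <= y -> y <= z -> (y + z) `^ s' <= z `^ s' * 2 `^ s'.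
  move=> y0 yz; have z0 := le_trans y0 yz; rewrite mulrC -powRM//.
  by rewrite ge0_ler_powR ?nnegrE ?(ltW s'_gt0) ?addr_ge0 ?mulr_ge0// mulrDl mul1r lerD2r.
have [wW|Ww] := leP w W.
  by rewrite (le_trans (max2 _ _ w0 wW))// ler_wpM2r ?powR_ge0// lerDl powR_ge0.
rewrite addrC (le_trans (max2 _ _ W0 (ltW Ww)))// ler_wpM2r ?powR_ge0// lerDr.
exact: powR_ge0.
Qed.

End exponential.

(** * Choice of the constants in all the cases *)

Theorem theorem1p1 (R : realType) (s : R) (s_gt0 : 0 < s) :
  [/\ (* (1) *)
      forall p : R, 0 < p < s ->
      exists C : R, [/\ 0 < C,
        (1 <= p -> let s' := s / (s - 1) in
          C = 64 * 2 `^ s * ((s - 1) / (s - p)) `^ (1 / s')) &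
        forall (d : measure_display) (X : borelMetricType R d)
          (mu : {measure set X -> \bar R}) (b : R) (u g : X -> R),
        standing_hypotheses mu s b p u g ->
        let pstar := s * p / (s - p) in
        (ereal_inf (range (fun gamma : R =>
              'N[mu]_(pstar%:E)[(fun x => (u x - gamma)%:E)]))
            <= (C * b `^ (- (1 / s)))%:E * 'N[mu]_(p%:E)[EFin \o g])%E /\
        (1 <= pstar ->
          mu.-integrable [set: X] (EFin \o u) /\
          ('N[mu]_(pstar%:E)[(fun x => (u x - average mu u)%:E)]
            <= (2 * C * b `^ (- (1 / s)))%:E * 'N[mu]_(p%:E)[EFin \o g])%E)],
      (* (2), s > 1 *)
      (1 < s ->
      exists c C : R, [/\ 0 < c, 0 < C &
        forall (d : measure_display) (X : borelMetricType R d)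
          (mu : {measure set X -> \bar R}) (b : R) (u g : X -> R),
        standing_hypotheses mu s b s u g ->
        (0 < 'N[mu]_(s%:E)[EFin \o g])%E ->
        mu.-integrable [set: X] (EFin \o u) /\
        (((fine (mu [set: X]))^-1)%:E *
          \int[mu]_x (expR (c *
            (b `^ (1 / s) * `|u x - average mu u|
              / fine 'N[mu]_(s%:E)[EFin \o g]) `^ (s / (s - 1))))%:E
          <= C%:E)%E]),
      (* (2), s <= 1 *)
      (s <= 1 ->
      exists C : R, 0 < C /\
        forall (d : measure_display) (X : borelMetricType R d)
          (mu : {measure set X -> \bar R}) (b : R) (u g : X -> R),
        standing_hypotheses mu s b s u g ->
        mu.-integrable [set: X] (EFin \o u) /\
        ('N[mu]_(+oo)[(fun x => (u x - average mu u)%:E)]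
          <= (C * b `^ (- (1 / s)))%:E * 'N[mu]_(s%:E)[EFin \o g])%E) &
      (* (3) *)
      forall p : R, s < p ->
      exists C : R, 0 < C /\
        forall (d : measure_display) (X : borelMetricType R d)
          (mu : {measure set X -> \bar R}) (b : R) (u g : X -> R),
        standing_hypotheses mu s b p u g ->
        mu.-integrable [set: X] (EFin \o u) /\
        ('N[mu]_(+oo)[(fun x => (u x - average mu u)%:E)]
          <= (C * b `^ (- (1 / s)) * fine (mu [set: X]) `^ (1 / s - 1 / p))%:E
             * 'N[mu]_(p%:E)[EFin \o g])%E].
Proof.
split.
- move=> p /andP[p0 ps].
  pose q := s * p / (s - p).
  have sp0 : 0 < s - p by rewrite subr_gt0.
  have q0 : 0 < q by rewrite divr_gt0 ?mulr_gt0.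
  (* The ranges [p < 1] and [p >= 1] differ only in the constants: [k] for the dyadic sum, and [C]
     above the resulting Sobolev constant. *)
  suff [k [C [k0 CE kE kC]]] : exists k C : R, [/\ 0 <= k,
      (1 <= p -> let s' := s / (s - 1) in
        C = 64 * 2 `^ s * ((s - 1) / (s - p)) `^ (1 / s')),
      dyadic_sum_bound s p k (fun l n => dyadic l n `^ (1 - p / s)) &
      2 * 3 `^ (1 / q) * (2 * 2 `^ (1 / s) + 6 * k) <= C].
    exists C; split => //.
      rewrite (lt_le_trans _ kC)// !mulr_gt0 ?powR_gt0//.
      by rewrite ltr_wpDr ?mulr_ge0// mulr_gt0 ?powR_gt0.
    move=> d X mu b u g hyp.
    have [gamma hg] := sobolev_subcritical s_gt0 p0 hyp ps k0 kE.
    have {}hg : ('N[mu]_(q%:E)[(fun x => (u x - gamma)%:E)] <=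
        (C * b `^ (- (1 / s)))%:E * 'N[mu]_(p%:E)[EFin \o g])%E.
      apply: le_trans hg _; rewrite lee_wpmul2r ?Lnorm_ge0// lee_fin.
      by rewrite ler_wpM2r ?powR_ge0.
    split; first by apply: le_trans hg; apply: ereal_inf_lbound; exists gamma.
    move=> q1; move: hg; rewrite (Lnorm_gE p0 hyp) -EFinM => hg.
    have [iu uN] := Lnorm_sub_average (mu_gt0 hyp) (mu_lty hyp) q1 (measurable_u hyp) hg.
    by split => //; rewrite -EFinM -!mulrA; move: uN; rewrite -!mulrA.
  have [p1|p1] := leP 1 p; last first.
    pose k := (2 `^ (1 - p / s) - 1)^-1 * (1 - 2 `^ (- p))^-1 `^ (1 / s).
    exists k, (2 * 3 `^ (1 / q) * (2 * 2 `^ (1 / s) + 6 * k)).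
    split; [|by []|exact: dyadic_sum_bound_subcritical|by []].
    rewrite mulr_ge0 ?powR_ge0// invr_ge0 subr_ge0 ltW// powR2_gt1//.
    by rewrite subr_gt0 ltr_pdivrMr// mul1r.
  have s1 : 1 < s := le_lt_trans p1 ps.
  pose A := ((s - 1) / (s - p)) `^ (1 - 1 / s).
  exists (2 * A), (64 * 2 `^ s * A); split.
  + by rewrite mulr_ge0// powR_ge0.
  + move=> _ /=; congr (_ * _ `^ _).
    by field; rewrite subr_eq0 (gt_eqF s1) (gt_eqF s_gt0).
  + exact: dyadic_sum_bound_hoelder.
  have A1 : 1 <= A.
    rewrite -[leLHS](powRr0 ((s - 1) / (s - p))) ler_powR//.
      by rewrite ler_pdivlMr// mul1r lerD2l lerN2.
    by rewrite subr_ge0 ler_pdivrMr// mul1r ltW.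
  have x2 : 2 `^ (1 / s) <= 2 :> R.
    by rewrite ler1_powR ?ler1n// ler_pdivrMr// mul1r ltW.
  have y2 : 2 <= 2 `^ s :> R by rewrite le1r_powR ?ler1n// ltW.
  have z3 : 3 `^ (1 / q) <= 3 :> R.
    rewrite ler1_powR ?ler1n// (_ : 1 / q = 1 / p - 1 / s); last first.
      by rewrite /q; field; rewrite (gt_eqF s_gt0) (gt_eqF sp0) (gt_eqF p0).
    rewrite lerBlDr (@le_trans _ _ 1)//; first by rewrite ler_pdivrMr// mul1r.
    by rewrite lerDl divr_ge0 ?ltW.
  have A0 : 0 <= A by rewrite powR_ge0.
  have x0 : 0 <= 2 `^ (1 / s) :> R by rewrite powR_ge0.
  (* With [k = 2 * A], [A >= 1] and both [2^(1/s) <= 2] and [3^(1/q) <= 3], the constant is at most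
     [96 * A], below [64 * 2 * A]; finally [2 <= 2^s]. *)
  apply: (@le_trans _ _ (2 * 3 * (2 * (2 * A) + 6 * (2 * A)))).
    apply: ler_pM; first by rewrite mulr_ge0 ?powR_ge0.
    - by rewrite addr_ge0 ?mulr_ge0.
    - by rewrite ler_wpM2l.
    by rewrite lerD2r ler_wpM2l// (le_trans x2)// ler_peMr.
  apply: (@le_trans _ _ (64 * 2 * A)); first by lra.
  by rewrite ler_wpM2r// ler_wpM2l.
- move=> s1.
  have c0 : 0 < exp_rate s.
    by rewrite divr_gt0 ?powR_gt0// mulr_gt0// ln_gt0// ltr1n.
  exists (exp_rate s / 2 `^ (s / (s - 1))).
  exists (expR (exp_rate s * (1 + 2 * 4 `^ s / exp_rate s) `^ (s / (s - 1))) *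
          (2 * 4 `^ s)).
  split; [by rewrite divr_gt0 ?powR_gt0|by rewrite !mulr_gt0 ?expR_gt0 ?powR_gt0|].
  move=> d X mu b u g hyp; rewrite (Lnorm_gE s_gt0 hyp) lte_fin => G0.
  have {}G0 : 0 < energy mu s g.
    by apply: gt0_powR G0; rewrite ?divr_gt0 ?energy_ge0.
  have [iu H] := exponential_integrability s1 hyp G0.
  split => //; have M0 := mass_gt0 hyp.
  rewrite -(@lee_pmul2l _ (mass mu)%:E)// muleA -EFinM divff ?gt_eqF// mul1e.
  by rewrite -EFinM [mass mu * _]mulrC; exact: H.
- move=> s1; exists (2 * (2 * 2 `^ (1 / s) + 3 * (1 - 2 `^ (- s))^-1 `^ (1 / s))).
  split.
    by rewrite mulr_gt0// ltr_wpDr ?mulr_ge0 ?powR_ge0// mulr_gt0 ?powR_gt0.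
  move=> d X mu b u g hyp.
  (* The supercritical estimate at [p = s], where the mass enters with power [0]. *)
  have := sobolev_supercritical s_gt0 s_gt0 hyp (lexx s) (powR_ge0 _ _)
    (dyadic_sum_bound_critical_le1 s_gt0 s1).
  by rewrite subrr powRr0 mulr1.
move=> p sp; have p0 : 0 < p := lt_trans s_gt0 sp.
pose k := (1 - 2 `^ (1 - p / s))^-1 * (1 - 2 `^ (- p))^-1 `^ (1 / s).
have k0 : 0 <= k.
  rewrite mulr_ge0 ?powR_ge0// invr_ge0 subr_ge0 ltW// powR2_lt1//.
  by rewrite subr_lt0 ltr_pdivlMr// mul1r.
exists (2 * (2 * 2 `^ (1 / s) + 3 * k)); split.
  by rewrite mulr_gt0// ltr_wpDr ?(mulr_ge0 _ k0)// mulr_gt0 ?powR_gt0.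
move=> d X mu b u g hyp.
exact: (sobolev_supercritical s_gt0 p0 hyp (ltW sp) k0
  (dyadic_sum_bound_supercritical s_gt0 sp)).
Qed.
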